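(* Let $q$ be a prime power and let $n$ be a positive integer with $\gcd(n,q)=1$. Then $\operatorname{Aut}_q(n)\neq\operatorname{Aff}_q(n)$ if and only if at least one of the following holds: (E1) $\operatorname{idx}_{n/p}(q)=\operatorname{idx}_n(q)$ for some prime $p\ge5$ with $p\,\|\,n$; (E2) $\operatorname{idx}_{n/p}(q)=\operatorname{idx}_n(q)$ for some odd prime $p$ with $p^2\mid n$; (E3) $8\mid n$ and $\operatorname{idx}_{n/4}(q)=\operatorname{idx}_n(q)$.
   Context: For a positive integer $d$ coprime to $q$, $\operatorname{ord}_d(q)$ is the order of $q$ in $\mathbb{Z}_d^\times=(\mathbb{Z}/d\mathbb{Z})^\times$, and $\operatorname{idx}_d(q):=\varphi(d)/\operatorname{ord}_d(q)$, where $\varphi$ is Euler's totient function. For a prime $p$, $p\,\|\,n$ means that $p\mid n$ and $p^2\nmid n$. Let $\langle q\rangle$ be the subgroup of $\mathbb{Z}_n^\times$ generated by $q$, where $\mathbb{Z}_n=\mathbb{Z}/n\mathbb{Z}$. The cyclotomic association scheme $\operatorname{Cyc}(\langle q\rangle,\mathbb{Z}_n)$ is the pair $(\mathbb{Z}_n,\pi)$ with coloring $\pi(x,y):=(y-x)\langle q\rangle$ (the orbit of $y-x$ under multiplication by $\langle q\rangle$), and $\operatorname{Aut}_q(n):=\operatorname{Aut}(\operatorname{Cyc}(\langle q\rangle,\mathbb{Z}_n))$ is the group of all permutations $\sigma$ of $\mathbb{Z}_n$ with $\pi(\sigma x,\sigma y)=\pi(x,y)$ for all $x,y\in\mathbb{Z}_n$.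 The $q$-affine group is $\operatorname{Aff}_q(n):=\{x\mapsto kx+b:\ k\in\langle q\rangle,\ b\in\mathbb{Z}_n\}=\mathbb{Z}_n\rtimes\langle q\rangle\le\operatorname{Sym}(\mathbb{Z}_n)$, generated by the shift $i\mapsto i+1$ and the multiplier $i\mapsto qi$. It is a subgroup of $\operatorname{Aut}_q(n)$. *)

(* Defs.v *)
From mathcomp Require Import all_boot all_order all_algebra all_fingroup.

Set Implicit Arguments.
Unset Strict Implicit.
Unset Printing Implicit Defensive.

Import GRing.Theory.
Local Open Scope ring_scope.

Definition prime_power (q : nat) : Prop :=
  exists p k : nat, [/\ prime p, (0 < k)%N & q = (p ^ k)%N].

(* p || n *)
Definition exactly_divides (p n : nat) : bool :=
  (p %| n)%N && ~~ (p ^ 2 %| n)%N.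

(* The class of q in the unit group of Z/d, for q coprime to d; the default
   value 1 is reached only when q is not coprime to d.  For d = 1, 'Z_1 is Z/2,
   but its unit group is trivial, as is that of Z/1. *)
Definition zunit (d q : nat) : {unit 'Z_d} :=
  insubd (1%g : {unit 'Z_d}) (q%:R : 'Z_d).

Definition ordmod (d q : nat) : nat := #[zunit d q]%g.

(* For q coprime to d > 0 the division is exact, the unit group having
   cardinality totient d. *)
Definition idxmod (d q : nat) : nat := (totient d %/ ordmod d q)%N.

(* The group Z/n for every n > 0, including n = 1, which 'Z_n excludes. *)
Definition Zmod (n : nat) : finZmodType := 'I_n.-1.+1.

Definition umul (n : nat) (k : {unit 'Z_n}) (x : Zmod n) : Zmod n :=
  Zp_mul (inZp (FinRing.uval k)) x.

Definition cyc_color (n q : nat) (x y : Zmod n) : {set Zmod n} :=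
  [set umul k (y - x) | k in <[zunit n q]>%g].

Definition cyc_aut (n q : nat) : {set {perm Zmod n}} :=
  [set s : {perm Zmod n} |
    [forall x, forall y, cyc_color q (s x) (s y) == cyc_color q x y]].

Definition cyc_aff (n q : nat) : {set {perm Zmod n}} :=
  [set s : {perm Zmod n} |
    [exists k in <[zunit n q]>%g, exists b : Zmod n,
      forall x, s x == umul k x + b]].

(* Main.v *)
Require Import Defs.
From mathcomp Require Import all_boot all_order all_algebra all_fingroup.
From mathcomp Require Import all_solvable zify ring.

(**
Write K for the subgroup generated by q.  The equality idx_m(q) = idx_n(q), for
m dividing n, says that K contains the whole kernel of the reduction
(Z/n)^* -> (Z/m)^*.

If K contains such a kernel, then the following automorphisms are not affine:
under (E1) a transposition acting on the component Z/p of Z/n; under (E2) and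
(E3) the map adding c to the multiples of d and fixing every other point, with
(d, c) = (p, n/p) and (4, n/2) respectively.

Conversely, normalise an automorphism to fix 0 and 1, and let n = p^e m with p
not dividing m.  Applying the condition on colours to points that are 0 and 1
modulo m shows that g y - g x = k (y - x) modulo p^e with k in the subgroup
K_p of the elements of K that are 1 modulo m.  If K contains none of the
kernels above, then g is the identity modulo p^e:
- for p odd and e > 1, an element of K_p that is 1 modulo p is 1 modulo p^e, and
  comparing g at x, y and y + p forces all the multipliers to be 1;
- for p = 2, two consecutive fixed points x, x + 1 force the next one, because
  k and 2 k - 1 lie together in K_p only if 2 k = 2;
- for p > 3 and e = 1, K_p has order d < p - 1 modulo p, and
  (g y - g x)^d = (y - x)^d makes g^j a polynomial of degree at most d for every
  j <= d; as 2 d < p, this is possible only if g has degree 1.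
*)

Set Implicit Arguments.
Unset Strict Implicit.
Unset Printing Implicit Defensive.

Import GRing.Theory.

(** * Reduction of unit groups *)

Lemma zunit_val d a : 1 < d -> coprime d a ->
  FinRing.uval (zunit d a) = (a%:R : 'Z_d)%R.
Proof.
move=> d_gt1 cda; rewrite /zunit.
have ua : (a%:R : 'Z_d)%R \is a GRing.unit by rewrite unitZpE.
exact: (insubdK (1%g : {unit 'Z_d}) ua).
Qed.

Lemma unit_Z1 (u v : {unit 'Z_1}) : u = v.
Proof.
have /card_le1_eqP : #|units_Zp 1| <= 1 by rewrite card_units_Zp.
by apply; rewrite inE.
Qed.

Lemma eqr_modn d a b : 1 < d ->
  ((a%:R : 'Z_d)%R = b%:R%R) <-> a = b %[mod d].
Proof.
move=> d_gt1; split; last by move=> e; rewrite -(Zp_nat_mod d_gt1 a) e Zp_nat_mod.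
by move=> /(congr1 val) /=; rewrite !val_Zp_nat.
Qed.

Lemma zunit_eq d a b : 0 < d -> coprime d a -> coprime d b ->
  zunit d a = zunit d b <-> a = b %[mod d].
Proof.
case: d => [|[|d]] // _ ca cb; first by split=> // _; [rewrite !modn1 | exact: unit_Z1].
rewrite -(eqr_modn _ _ (isT : 1 < d.+2)) -!zunit_val //; split=> [->//|].
exact: val_inj.
Qed.

Lemma zunitM d a b : 0 < d -> coprime d a -> coprime d b ->
  zunit d (a * b) = (zunit d a * zunit d b)%g.
Proof.
case: d => [|[|d]] // _ ca cb; first exact: unit_Z1.
apply: val_inj; rewrite /= !zunit_val ?coprimeMr ?ca //.
by rewrite natrM.
Qed.

Lemma zunit1 d : 0 < d -> zunit d 1 = 1%g.
Proof.
case: d => [|[|d]] // _; first exact: unit_Z1.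
by apply: val_inj; rewrite /= zunit_val ?coprimen1.
Qed.

Lemma zunitX d a i : 0 < d -> coprime d a -> zunit d (a ^ i) = (zunit d a ^+ i)%g.
Proof.
move=> d0 ca; elim: i => [|i IH]; first by rewrite zunit1.
by rewrite expnS expgS zunitM ?IH // coprimeXr.
Qed.

Lemma zunit_repr d (u : {unit 'Z_d}) : 0 < d ->
  exists2 a, coprime d a & u = zunit d a.
Proof.
case: d u => [|[|d]] // u _; first by exists 1 => //; exact: unit_Z1.
exists (FinRing.uval u).
  by rewrite -(unitZpE _ (isT : 1 < d.+2)) natr_Zp; exact: (valP u).
have c : coprime d.+2 (FinRing.uval u).
  by rewrite -(unitZpE _ (isT : 1 < d.+2)) natr_Zp; exact: (valP u).
by apply: val_inj; rewrite /= zunit_val // natr_Zp.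
Qed.

Lemma expn_ordmod d a i : 0 < d -> coprime d a ->
  a ^ i = 1 %[mod d] <-> ordmod d a %| i.
Proof.
move=> d0 ca; rewrite -zunit_eq ?coprimen1 ?coprimeXr // zunitX // zunit1 //.
by rewrite /ordmod order_dvdn; split=> /eqP.
Qed.

Lemma zunit_cycle d a k : 0 < d -> coprime d a -> coprime d k ->
  zunit d k \in <[zunit d a]>%g <-> exists i, k = a ^ i %[mod d].
Proof.
move=> d0 ca ck; split.
  case/cycleP=> i; rewrite -zunitX // => /zunit_eq e; exists i; apply: e => //.
  by rewrite coprimeXr.
case=> i e; apply/cycleP; exists i; rewrite -zunitX //; apply/zunit_eq => //.
by rewrite coprimeXr.
Qed.

(** Take b congruent to a modulo m and to 1 modulo n', the part of n prime to m. The primes of the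
    other part of n all divide m, hence do not divide b. *)
Lemma coprime_lift m n a : 0 < n -> m %| n -> coprime m a ->
  exists2 b, coprime n b & b = a %[mod m].
Proof.
move=> n0 dmn cma; have m0 := dvdn_gt0 n0 dmn.
have [m1|m1] := eqVneq m 1; first by exists 1; rewrite ?coprimen1 // m1 !modn1.
pose n' := n`_(\pi(m)^').
have cmn : coprime m n'.
  by rewrite -(part_pnat_id (pnat_pi m0)) coprime_partC.
exists (chinese m n' a 1); last exact: chinese_modl.
have cb : coprime (m * n') (chinese m n' a 1).
  rewrite coprimeMl -[coprime m _]coprime_modr chinese_modl // coprime_modr cma.
  by rewrite -[coprime n' _]coprime_modr chinese_modr // coprime_modr coprimen1.
set b := chinese _ _ _ _ in cb *.
have b0 : 0 < b.
  rewrite lt0n; apply: contraNneq m1 => b0; move: cb.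
  by rewrite b0 /coprime gcdn0 muln_eq1 => /andP[].
move: cb; rewrite coprimeMl => /andP[cb cb'].
rewrite -(partnC \pi(m) n0) coprimeMl cb' andbT.
by apply: (pnat_coprime (part_pnat _ _)); rewrite -coprime_pi'.
Qed.

Lemma eq_modn_dvd m n a b : m %| n -> a = b %[mod n] -> a = b %[mod m].
Proof. by move=> d e; rewrite -(modn_dvdm a d) e modn_dvdm. Qed.

Definition reduce m n (u : {unit 'Z_n}) : {unit 'Z_m} := zunit m (FinRing.uval u).

Lemma reduceE m n a : 0 < n -> m %| n -> coprime n a ->
  reduce m (zunit n a) = zunit m a.
Proof.
move=> n0 dmn ca.
have m0 := dvdn_gt0 n0 dmn; have cma := coprime_dvdl dmn ca.
case: n n0 dmn ca => [|[|n]] // _ dmn ca.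
  by move: dmn; rewrite dvdn1 => /eqP->; exact: unit_Z1.
rewrite /reduce zunit_val //.
have e : (a%:R : 'Z_n.+2)%R = a %[mod n.+2] by rewrite val_Zp_nat // modn_mod.
have e' := eq_modn_dvd dmn e.
apply/zunit_eq => //.
by rewrite -coprime_modr e' coprime_modr.
Qed.

Lemma reduceM m n : 0 < n -> m %| n ->
  {in [set: {unit 'Z_n}] &, {morph @reduce m n : u v / (u * v)%g}}.
Proof.
move=> n0 dmn u v _ _; have m0 := dvdn_gt0 n0 dmn.
have [a ca ->] := zunit_repr u n0; have [b cb ->] := zunit_repr v n0.
by rewrite -zunitM // !reduceE ?coprimeMr ?ca // zunitM // (coprime_dvdl dmn).
Qed.

(** Reduction f of units modulo n to units modulo m is onto, with kernel N. Counting fibres on the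
    whole unit group and on K = <q> shows that idx_n(q) is the index of the intersection of K and N
    in N, times idx_m(q). Equality thus means that N lies in K. *)
Lemma idxmod_eqP m n q : 0 < n -> m %| n -> coprime n q ->
  idxmod m q = idxmod n q <->
  (forall k, coprime n k -> k = 1 %[mod m] -> exists i, k = q ^ i %[mod n]).
Proof.
move=> n0 dmn cq; have m0 := dvdn_gt0 n0 dmn; have cmq := coprime_dvdl dmn cq.
pose f := Morphism (reduceM n0 dmn).
have f_on a : coprime n a -> f (zunit n a) = zunit m a by move=> /reduceE; apply.
pose U := [set: {unit 'Z_n}]%G; pose K := <[zunit n q]>%G.
pose N := ('ker f)%G.
have im_K : (f @* K = <[zunit m q]>)%g by rewrite morphim_cycle ?inE // f_on.
have im_U : (f @* U = [set: {unit 'Z_m}])%g.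
  apply/eqP; rewrite eqEsubset subsetT /=; apply/subsetP=> v _.
  have [a ca ->] := zunit_repr v m0; have [b cb e] := coprime_lift n0 dmn ca.
  apply/morphimP; exists (zunit n b); rewrite ?inE // f_on //.
  by apply/zunit_eq => //; rewrite -coprime_modr e coprime_modr.
have cardE (A : {group {unit 'Z_n}}) : #|A| = (#|A :&: N| * #|(f @* A)%g|)%N.
  by rewrite card_morphim setTI -(LagrangeI A N) -indexgI.
have tnE : totient n = #|N| * totient m.
  by have := cardE U; rewrite im_U setTI -!card_units_Zp.
have onE : ordmod n q = #|K :&: N| * ordmod m q.
  by have := cardE K; rewrite im_K.
(* The quotient x is the index of q modulo m. *)
have /dvdnP[x tmE] : ordmod m q %| totient m.
  by rewrite -card_units_Zp //; apply: order_dvdG; rewrite inE.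
have jE : #|N| = #|K :&: N| * #|N : K|%g by rewrite setIC LagrangeI.
have om0 : 0 < ordmod m q by exact: order_gt0.
have x0 : 0 < x by move: (totient_gt0 m); rewrite m0 tmE muln_gt0 => /andP[].
have -> : idxmod m q = idxmod n q <-> N \subset K.
  rewrite -indexg_eq1 /idxmod tnE onE tmE mulnK // jE.
  rewrite (_ : _ * _ = x * #|N : K|%g * (#|K :&: N| * ordmod m q)); last by ring.
  rewrite mulnK ?muln_gt0 ?cardG_gt0 // -[X in X = _]muln1.
  by split=> [/eqP|/eqP->//]; rewrite eqn_pmul2l // eq_sym.
split=> [sub k ck e|H].
  apply/(zunit_cycle n0 cq ck); apply: (subsetP sub).
  apply/kerP; rewrite ?inE // f_on // -(zunit1 m0).
  by apply/zunit_eq => //; rewrite ?coprimen1 // (coprime_dvdl dmn).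
apply/subsetP=> u /(kerP _ (in_setT _)); have [k ck ->] := zunit_repr u n0.
rewrite f_on // -(zunit1 m0) => /zunit_eq e; apply/zunit_cycle => //.
by apply: H => //; apply: e; rewrite ?coprimen1 // (coprime_dvdl dmn).
Qed.

(** * Automorphisms as congruences *)

Lemma expn_inv n q i : 0 < n -> coprime n q -> exists j, q ^ j * q ^ i = 1 %[mod n].
Proof.
move=> n0 cq; exists (i * (totient n).-1); rewrite -expnD -mulnSr.
rewrite prednK ?totient_gt0 // mulnC expnM -modnXm Euler_exp_totient; last first.
  by rewrite coprime_sym.
by rewrite modnXm exp1n.
Qed.

(* [k] is kept apart from the power because the latter is elaborated along
   different structure paths in different contexts. *)
Lemma umulX n q i (k : {unit 'Z_n}) (z : Zmod n) :
  0 < n -> coprime n q -> k = (zunit n q ^+ i)%g -> umul k z = q ^ i * z %% n :> nat.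
Proof.
case: n k z => [|[|n]] // k z _ cq ->; first by rewrite modn1; case: (umul _ _) => -[].
by rewrite -zunitX //= zunit_val ?coprimeXr // val_Zp_nat // modn_mod modnMml.
Qed.

Lemma orbit_eqP n q (z z' : Zmod n) : 0 < n -> coprime n q ->
  [set umul k z' | k in <[zunit n q]>%g] = [set umul k z | k in <[zunit n q]>%g]
  <-> exists i, z' = q ^ i * z %[mod n].
Proof.
move=> n0 cq; have zlt (t : Zmod n) : t < n by rewrite -[X in _ < X]prednK.
have memP (t s : Zmod n) : s \in [set umul k t | k in <[zunit n q]>%g] <->
    exists i, s = q ^ i * t %[mod n].
  split=> [/imsetP[k /cycleP[i ->] ->]|[i e]].
by exists i; rewrite (@umulX n q i) ?modn_mod.
  apply/imsetP; exists (zunit n q ^+ i)%g; first exact: mem_cycle.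
  by apply: ord_inj; rewrite (@umulX n q i) // -e modn_small.
have sub (t s : Zmod n) i : s = q ^ i * t %[mod n] ->
    [set umul k s | k in <[zunit n q]>%g] \subset [set umul k t | k in <[zunit n q]>%g].
  move=> e; apply/subsetP=> r /memP[j ej]; apply/memP; exists (j + i).
  by rewrite ej -modnMmr e modnMmr mulnA expnD.
split=> [e|[i e]]; first by apply/memP; rewrite -e; apply/memP; exists 0; rewrite mul1n.
apply/eqP; rewrite eqEsubset (sub _ _ _ e) /=.
have [j ej] := expn_inv i n0 cq; apply: (sub _ _ j).
by rewrite -modnMmr e modnMmr mulnA -modnMml ej modnMml mul1n.
Qed.

Lemma Zmod_subK n (x y : Zmod n) : 0 < n -> (y - x)%R + x = y %[mod n].
Proof.
case: n x y => // n x y _.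
have e : ((y - x)%R + x)%R = y by rewrite subrK.
by rewrite -[in RHS]e /= modn_mod.
Qed.

(** The relation y' - x' = q^i (y - x), with the negative terms moved across so that it is a
    congruence of natural numbers. *)
Lemma cyc_color_eqP n q (x y x' y' : Zmod n) : 0 < n -> coprime n q ->
  cyc_color q x' y' = cyc_color q x y <->
  exists i, y' + q ^ i * x = x' + q ^ i * y %[mod n].
Proof.
move=> n0 cq; rewrite orbit_eqP //.
have E i : y' + q ^ i * x = x' + q ^ i * y %[mod n] <->
    (y' - x')%R = q ^ i * (y - x)%R %[mod n].
  have -> : y' + q ^ i * x = x' + q ^ i * x + (y' - x')%R %[mod n].
    rewrite -modnDml -(Zmod_subK x' y') // modnDml; congr (_ %% _); ring.
  have -> : x' + q ^ i * y = x' + q ^ i * x + q ^ i * (y - x)%R %[mod n].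
    rewrite -modnDmr -modnMmr -(Zmod_subK x y) // modnMmr modnDmr.
    congr (_ %% _); ring.
  by split=> /eqP e; apply/eqP; move: e; rewrite eqn_modDl.
by split=> -[i /E e]; exists i.
Qed.

Definition Zmod_of n (x : nat) : Zmod n := inZp x.
Arguments Zmod_of : clear implicits.

Lemma Zmod_ofE n x : 0 < n -> Zmod_of n x = x %% n :> nat.
Proof. by case: n. Qed.

Lemma Zmod_ofK n (x : Zmod n) : Zmod_of n x = x.
Proof. by apply: val_inj => /=; rewrite modn_small. Qed.

Lemma Zmod_of_eq n x y : 0 < n -> Zmod_of n x = Zmod_of n y <-> x = y %[mod n].
Proof.
move=> n0; split=> [/(congr1 val)/=|e]; first by rewrite prednK.
by apply: val_inj; rewrite /= prednK.
Qed.

(** Stated for maps on natural numbers, so that Chinese remainders and reduction modulo divisors of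
    n apply directly. Compatibility with congruence modulo n is a consequence, see
    [color_preserving_eq]. *)
Definition color_preserving n q (g : nat -> nat) :=
  forall x y, exists i, g y + q ^ i * x = g x + q ^ i * y %[mod n].

Lemma cyc_aut_preserving n q s : 0 < n -> coprime n q ->
  s \in cyc_aut n q -> color_preserving n q (fun x => s (Zmod_of n x)).
Proof.
move=> n0 cq; rewrite inE => /forallP H x y.
have /eqP/cyc_color_eqP := forallP (H (Zmod_of n x)) (Zmod_of n y).
case=> // i e; exists i; move: e; rewrite !Zmod_ofE //.
rewrite -[X in X = _ -> _]modnDmr modnMmr modnDmr => ->.
by rewrite -modnDmr modnMmr modnDmr.
Qed.

Lemma eqn_expMl n q i a b : 0 < n -> coprime n q ->
  q ^ i * a = q ^ i * b %[mod n] -> a = b %[mod n].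
Proof.
move=> n0 cq e; have [j ej] := expn_inv i n0 cq.
suff K c : c = q ^ j * (q ^ i * c) %[mod n] by rewrite K -modnMmr e modnMmr -K.
by rewrite mulnA -modnMml ej modnMml mul1n.
Qed.

(** Powers of q are invertible modulo n, so g y - g x and y - x vanish together; hence g descends to
    an injection of Z/n. *)
Lemma color_preserving_eq n q g x y : 0 < n -> coprime n q -> color_preserving n q g ->
  g x = g y %[mod n] <-> x = y %[mod n].
Proof.
move=> n0 cq gP; have [i e] := gP x y; split=> e1.
  apply: (eqn_expMl (i := i) n0 cq); apply/eqP; rewrite -(eqn_modDl (g y)) e.
  by rewrite eqn_modDr e1.
apply/eqP; rewrite eq_sym -(eqn_modDr (q ^ i * x)) e.
by rewrite eqn_modDl -modnMmr -e1 modnMmr.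
Qed.

Lemma preserving_cyc_aut n q g : 0 < n -> coprime n q -> color_preserving n q g ->
  exists2 s, s \in cyc_aut n q & forall x, s (Zmod_of n x) = Zmod_of n (g x).
Proof.
move=> n0 cq gP.
have s_inj : injective (fun x : Zmod n => Zmod_of n (g x)).
  move=> x y /(Zmod_of_eq _ _ n0)/color_preserving_eq e.
  by apply: val_inj; move: (e _ n0 cq gP); rewrite !modn_small // -[X in _ < X]prednK.
exists (perm s_inj) => [|x]; last first.
  rewrite permE; apply/Zmod_of_eq=> //; apply/(color_preserving_eq _ _ n0 cq gP).
  by rewrite Zmod_ofE ?modn_mod.
rewrite inE; apply/forallP=> x; apply/forallP=> y; apply/eqP/cyc_color_eqP=> //.
have [i e] := gP x y; exists i; rewrite !permE !Zmod_ofE //.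
by rewrite modnDml e modnDml.
Qed.

Lemma Zmod_addE n (x y : Zmod n) : 0 < n -> (x + y)%R = (x + y) %% n :> nat.
Proof. by case: n x y. Qed.

Lemma cyc_affP n q (s : {perm Zmod n}) : 0 < n -> coprime n q ->
  s \in cyc_aff n q <->
  exists i b, forall x, s (Zmod_of n x) = Zmod_of n (q ^ i * x + b).
Proof.
move=> n0 cq; rewrite inE.
have E i b x : (umul (zunit n q ^+ i)%g (Zmod_of n x) + Zmod_of n b)%R =
    Zmod_of n (q ^ i * x + b).
  apply: ord_inj; rewrite Zmod_addE // (@umulX n q i) // !Zmod_ofE //.
  by rewrite modnMmr modnDm.
split=> [/existsP[k /andP[/cycleP[i ->] /existsP[b /forallP H]]]|[i [b H]]].
  by exists i, b => x; rewrite (eqP (H _)) -E Zmod_ofK.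
apply/existsP; exists (zunit n q ^+ i)%g; rewrite mem_cycle /=.
apply/existsP; exists (Zmod_of n b); apply/forallP=> x.
by rewrite -[x in s x]Zmod_ofK H -E Zmod_ofK.
Qed.

Lemma cyc_aff_sub n q : 0 < n -> coprime n q -> cyc_aff n q \subset cyc_aut n q.
Proof.
move=> n0 cq; apply/subsetP=> s /(cyc_affP _ n0 cq)[i [b H]].
rewrite inE; apply/forallP=> x; apply/forallP=> y; apply/eqP/cyc_color_eqP=> //.
have sE (z : Zmod n) : s z = Zmod_of n (q ^ i * z + b) by rewrite -H Zmod_ofK.
exists i; rewrite !sE !Zmod_ofE // modnDml [in RHS]modnDml; congr (_ %% _); ring.
Qed.

(** * Automorphisms that are not affine *)

(** By [idxmod_eqP] this expresses equality of the indices of q modulo m and n; the constructions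
    and the rigidity arguments use only this form. *)
Definition kernel_in_powers m n q :=
  forall k, coprime n k -> k = 1 %[mod m] -> exists i, k = q ^ i %[mod n].

Lemma modn_lin d a a' k k' b b' : a = a' %[mod d] -> k = k' %[mod d] ->
  b = b' %[mod d] -> a + k * b = a' + k' * b' %[mod d].
Proof.
by move=> ea ek eb; rewrite -[LHS]modnDm -[k * b %% d]modnMm ea ek eb modnMm modnDm.
Qed.

(** An affine map fixing two consecutive points has slope 1 and translation 0, so it cannot move
    0. *)
Lemma cyc_aut_neq n q g j : 0 < n -> coprime n q -> color_preserving n q g ->
  g j = j %[mod n] -> g j.+1 = j.+1 %[mod n] -> g 0 != 0 %[mod n] ->
  cyc_aut n q <> cyc_aff n q.
Proof.
move=> n0 cq gP gj gj1 g0 eA.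
have [s] := preserving_cyc_aut n0 cq gP; rewrite eA => /(cyc_affP _ n0 cq)[i [b H]] sE.
have E x : g x = q ^ i * x + b %[mod n] by apply/Zmod_of_eq; rewrite // -sE H.
have n1 : 1 < n by case: n n0 g0 {cq gP s sE gj gj1 eA b H E} => [|[|n]] //; rewrite !modn1.
case/eqP: g0; move: gj gj1; rewrite !E => /(eqr_modn _ _ n1) gj /(eqr_modn _ _ n1) gj1.
apply/(eqr_modn _ _ n1); move: gj gj1; rewrite !natrD !natrM !mulrS mulr0.
set Q := ((q ^ i)%:R)%R; set B := (b%:R)%R; set J := (j%:R)%R => gj gj1.
have {}gj1 : Q = 1%R.
  have -> : Q = (Q * (1 + J) + B - (Q * J + B))%R by ring.
  by rewrite gj1 gj; ring.
rewrite add0r; have -> : (B = Q * J + B - J)%R by rewrite gj1; ring.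
by rewrite gj subrr.
Qed.

Lemma eqr_Fp p a b : prime p -> ((a%:R : 'F_p)%R = b%:R%R) <-> a = b %[mod p].
Proof.
move=> pp; split; last by move=> e; rewrite -(Fp_nat_mod pp a) e Fp_nat_mod.
by move=> /(congr1 val) /=; rewrite !val_Fp_nat.
Qed.

(** The map g swaps 0 and 1 modulo p and is the identity modulo m. Any two differences that are
    nonzero modulo p differ by a unit factor, and K contains every unit that is 1 modulo m. As p >=
    5, the residues 2 and 3 stay fixed. *)
Lemma cyc_aut_neq_transposition p m q : prime p -> 5 <= p -> 0 < m -> coprime m p ->
  coprime (m * p) q -> kernel_in_powers m (m * p) q -> cyc_aut (m * p) q <> cyc_aff (m * p) q.
Proof.
move=> pp p5 m0 cmp cq H; have n0 : 0 < m * p by rewrite muln_gt0 m0 prime_gt0.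
pose t r := if r == 0 then 1 else if r == 1 then 0 else r.
pose g x := chinese m p x (t (x %% p)).
have gm x : g x = x %[mod m] by rewrite chinese_modl.
have gp x : g x = t (x %% p) %[mod p] by rewrite chinese_modr. clearbody g.
have t_inj x y : t (x %% p) = t (y %% p) %[mod p] -> x = y %[mod p].
  have tlt r : r < p -> t r < p by rewrite /t; do 2?case: ifP => _; lia.
  have p0 : 0 < p by lia.
  rewrite !(modn_small (tlt _ _)) ?ltn_mod // /t.
  by do 4?case: eqP => ?; lia.
have gP : color_preserving (m * p) q g.
  move=> x y; have [u [cu eu]] : exists u, coprime p u /\
      g y + u * x = g x + u * y %[mod p].
    have [e|/eqP ne] := eqVneq (x %% p) (y %% p).
      exists 1; split; first exact: coprimen1.
      have /(eqr_Fp _ _ pp) eg : g x = g y %[mod p] by rewrite !gp e.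
      by apply/(eqr_Fp _ _ pp); rewrite !mul1n !natrD eg; move/(eqr_Fp _ _ pp): e => ->.
    pose D (a b : nat) := (b%:R - a%:R : 'F_p)%R.
    have Dneq0 a b : a <> b %[mod p] -> D a b != 0%R.
      by move=> nab; rewrite /D subr_eq0; apply/eqP=> /(eqr_Fp _ _ pp)/esym.
    pose v : 'F_p := (D (g x) (g y) / D x y)%R.
    have vR : ((v : nat)%:R)%R = v by exact: natr_Zp.
    have nxy := Dneq0 _ _ ne.
    have ng : D (g x) (g y) != 0%R.
      by apply: Dneq0; rewrite !gp => /t_inj.
    exists v; split; first by rewrite -unitFpE // vR unitfE mulf_neq0 ?invr_neq0.
    apply/(eqr_Fp _ _ pp); rewrite !natrD !natrM vR.
    have : (v * D x y = D (g x) (g y))%R by rewrite mulfVK.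
    rewrite /D => e; have -> : ((g y)%:R = v * (y%:R - x%:R) + (g x)%:R :> 'F_p)%R.
      by rewrite e subrK.
    by ring.
  (* The unit that is 1 modulo m and u modulo p is in the kernel, hence a power of q. *)
  have [||i e] := H (chinese m p 1 u).
  - rewrite coprimeMl -coprime_modr chinese_modl // coprime_modr coprimen1.
    by rewrite -coprime_modr chinese_modr // coprime_modr.
  - by rewrite chinese_modl.
  exists i.
  have em : q ^ i = 1 %[mod m].
    by rewrite -(eq_modn_dvd (dvdn_mulr p (dvdnn m)) e) chinese_modl.
  have ep : q ^ i = u %[mod p].
    by rewrite -(eq_modn_dvd (dvdn_mull m (dvdnn p)) e) chinese_modr.
  apply/eqP; rewrite chinese_remainder //; apply/andP; split; apply/eqP.
    rewrite (modn_lin (gm y) em (erefl (x %% m))) (modn_lin (gm x) em (erefl (y %% m))).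
    by rewrite !mul1n addnC.
  rewrite (modn_lin (erefl (g y %% p)) ep (erefl (x %% p))) eu.
  exact/esym/modn_lin.
have gfix j : 1 < j < p -> g j = j %[mod m * p].
  move=> /andP[j1 jp]; have tj : t j = j by rewrite /t; do 2?case: eqP => ?; lia.
  by apply/eqP; rewrite chinese_remainder // gm gp (modn_small jp) tj (modn_small jp) !eqxx.
apply: (cyc_aut_neq n0 cq gP (gfix 2 _) (gfix 3 _)); try lia.
have t0 : t 0 = 1 by [].
by rewrite chinese_remainder // gp !mod0n negb_and t0 (modn_small (prime_gt1 pp)) orbT.
Qed.

(** Adding c on the multiples of d changes only differences z between a multiple and a non-multiple
    of d; the last hypothesis says that such a z and z + c have the same colour. As d > 2, the
    points 1 and 2 are fixed. *)
Lemma cyc_aut_neq_shift d c n q : 0 < n -> coprime n q -> 2 < d -> d %| n -> ~~ (n %| c) ->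
  (forall z, ~~ (d %| z) -> exists i, q ^ i * z = z + c %[mod n]) ->
  cyc_aut n q <> cyc_aff n q.
Proof.
move=> n0 cq d2 dn nc H.
pose g x := if d %| x then x + c else x.
have P x y : d %| x -> ~~ (d %| y) ->
    exists i, y + q ^ i * x = (x + c) + q ^ i * y %[mod n].
  (* Modulo n, z is x - y. *)
  move=> dx dy; pose z := x + n.-1 * y.
  have zE : z + y = x + n * y by rewrite /z -addnA -mulSnr prednK.
  have dz : ~~ (d %| z).
    by apply: contra dy => dz; rewrite -(dvdn_addr y dz) zE dvdn_addr ?dvdn_mulr.
  have [i e] := H z dz; exists i.
  have zx : z + y = x %[mod n] by rewrite zE -modnDmr modnMr addn0.
  rewrite -modnDmr -modnMmr -zx modnMmr modnDmr mulnDr addnCA -modnDml e modnDml.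
  rewrite -[X in _ = X %[mod _]]addnA -[RHS]modnDml -zx modnDml; congr (_ %% _); ring.
have gP : color_preserving n q g.
  move=> x y; rewrite /g; case: ifPn => dy; case: ifPn => dx.
  - by exists 0; congr (_ %% _); ring.
  - by have [i e] := P y x dy dx; exists i.
  - by have [i e] := P x y dx dy; exists i.
  - by exists 0; congr (_ %% _); ring.
have gfix j : 0 < j < d -> g j = j.
  by move=> /andP[j0 jd]; rewrite /g gtnNdvd.
apply: (@cyc_aut_neq _ _ g 1) => //; try by rewrite gfix ?d2 ?(ltnW d2).
by rewrite /g dvdn0 add0n mod0n.
Qed.

(** If t z = 1 modulo p, then (1 + c t) z = z + c modulo c p, and 1 + c t is in the kernel of
    reduction modulo c; it is a unit because p divides c. *)
Lemma cyc_aut_neq_odd p c q : prime p -> odd p -> 0 < c -> p %| c -> coprime (c * p) q ->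
  kernel_in_powers c (c * p) q -> cyc_aut (c * p) q <> cyc_aff (c * p) q.
Proof.
move=> pp op c0 pc cq H; have p0 := prime_gt0 pp.
apply: (@cyc_aut_neq_shift p c) => // [||||z dz]; first by rewrite muln_gt0 c0.
- exact: odd_prime_gt2.
- exact: dvdn_mull.
- by rewrite -[X in _ %| X]muln1 dvdn_pmul2l // dvdn1 gtn_eqF ?prime_gt1.
have [t tz] : exists t, t * z = 1 %[mod p].
  have cz : coprime p z by rewrite prime_coprime.
  by have [j e] := expn_inv 1 p0 cz; exists (z ^ j); rewrite -{2}[z]expn1.
have [||i e] := H (1 + c * t).
- rewrite coprimeMl andbC; have co : coprime c (1 + c * t).
    by rewrite -coprime_modr addnC mulnC modnMDl coprime_modr coprimen1.
  by rewrite co (coprime_dvdl pc co).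
- by rewrite addnC mulnC modnMDl.
exists i; rewrite -modnMml -e modnMml.
have tzE := divn_eq (t * z) p; rewrite tz modn_small ?prime_gt1 // in tzE.
have -> : (1 + c * t) * z = t * z %/ p * (c * p) + (z + c).
  by rewrite mulnDl mul1n -mulnA {1}tzE; ring.
exact: modnMDl.
Qed.

(** Modulo 4 w, the kernel element 1 + 2 w sends an odd z to z + 2 w, and 1 + w does the same for z
    equal to 2 modulo 4. *)
Lemma cyc_aut_neq_two w q : 0 < w -> 2 %| w -> coprime (w * 4) q ->
  kernel_in_powers w (w * 4) q -> cyc_aut (w * 4) q <> cyc_aff (w * 4) q.
Proof.
move=> w0 w2 cq H.
apply: (@cyc_aut_neq_shift 4 (w * 2)) => // [|||z dz]; first by rewrite muln_gt0 w0.
- exact: dvdn_mull.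
- by rewrite dvdn_pmul2l.
have [k [u [ck k1 kz]]] : exists k u, [/\ coprime (w * 4) k, k = 1 %[mod w]
    & k * z = u * (w * 4) + (z + w * 2)].
  have co v : coprime (w * 4) (1 + v * w).
    have cw : coprime w (1 + v * w).
      by rewrite -coprime_modr addnC modnMDl coprime_modr coprimen1.
    by rewrite coprimeMl cw (coprimeXl 2 (coprime_dvdl w2 cw)).
  have [oz|ez] := boolP (odd z).
    exists (1 + 2 * w), z./2; split=> //; first by rewrite addnC modnMDl.
    by rewrite -[X in _ * X]odd_double_half -[X in _ + (X + _)]odd_double_half oz; lia.
  exists (1 + 1 * w), (z %/ 4); split=> //; first by rewrite addnC modnMDl.
  have z4 : z %% 4 = 2 by lia.
  by rewrite [X in _ * X](divn_eq z 4) [X in _ + (X + _)](divn_eq z 4) z4; lia.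
have [i e] := H k ck k1.
by exists i; rewrite -modnMml -e modnMml kz modnMDl.
Qed.

(** * Rigidity over a ring *)

Lemma prime_ndvd_fact p n : prime p -> n < p -> ~~ (p %| n`!).
Proof.
move=> pp; elim: n => [|n IH] np; first by rewrite fact0 dvdn1 gtn_eqF ?prime_gt1.
by rewrite factS Euclid_dvdM // gtnNdvd //= IH // ltnW.
Qed.

Section Rigidity.
Local Open Scope ring_scope.

(** If x and x + 1 are fixed and k is the multiplier from x to x + 2, then the multiplier from x + 1
    to x + 2 is 2 k - 1. The hypothesis on K gives 2 k = 2, so x + 2 is fixed. *)
Lemma rigid_two (R : comNzRingType) (K : R -> Prop) (f : nat -> R) :
    f 0%N = 0 -> f 1%N = 1 ->
    (forall x y : nat, exists2 k, K k & f y - f x = k * (y%:R - x%:R)) ->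
    (forall k, K k -> K (2 * k - 1) -> 2 * k = 2) ->
  forall x, f x = x%:R.
Proof.
move=> f0 f1 fP K2 x.
suff: f x = x%:R /\ f x.+1 = x.+1%:R by case.
elim: x => [//|x [IH0 IH1]]; split=> //.
have [k Kk e] := fP x x.+2; have [k' Kk' e'] := fP x.+1 x.+2.
have -> : f x.+2 = x%:R + 2 * k by rewrite -[LHS](subrK (f x)) e IH0; ring.
rewrite (K2 k) //; first by ring.
suff -> : 2 * k - 1 = k' by [].
have -> : k' = f x.+2 - f x.+1 by rewrite e'; ring.
by rewrite -[f x.+2](subrK (f x)) e IH0 IH1; ring.
Qed.

(** When y - x is a unit, the multipliers from x to y and from x to y + p coincide, so f (y + p) = f
    y + k p. For y = 0 or 1 these values are known, which forces k = 1 and f x = x. *)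
Lemma rigid_odd (R : comUnitRingType) (K : R -> Prop) (f : nat -> R) (p : nat) :
    f 0%N = 0 -> f 1%N = 1 ->
    (forall x y : nat, exists2 k, K k & f y - f x = k * (y%:R - x%:R)) ->
    (forall k k' c, K k -> K k' -> k - k' = p%:R * c -> k = k') ->
    (forall k, K k -> p%:R * k = p%:R -> k = 1) ->
    (forall x : nat, (x%:R : R) \is a GRing.unit \/ (x%:R - 1 : R) \is a GRing.unit) ->
  forall x, f x = x%:R.
Proof.
move=> f0 f1 fP K_inj K1 U.
have shift (x y : nat) k : K k -> (y%:R - x%:R : R) \is a GRing.unit ->
    f y - f x = k * (y%:R - x%:R) -> f (y + p)%N = f y + k * p%:R.
  move=> Kk u e; have [k1 Kk1 e1] := fP x (y + p)%N.
  have [k2 Kk2 e2] := fP y (y + p)%N.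
  (* Going from x to y + p through y gives (k1 - k)(y - x) = p (k2 - k1), so k1 and k agree modulo
     p. *)
  have k1k : k1 = k.
    apply: (K_inj _ _ ((k2 - k1) / (y%:R - x%:R))) => //.
    apply: (mulIr u); rewrite -mulrA divrK //.
    have -> : (k1 - k) * (y%:R - x%:R) = (f (y + p)%N - f x) - (f y - f x) - k1 * p%:R.
      by rewrite e1 e natrD; ring.
    have -> : f (y + p)%N - f x - (f y - f x) = f (y + p)%N - f y by ring.
    by rewrite e2 natrD; ring.
  rewrite k1k in e1;   have -> : f (y + p)%N = f (y + p)%N - f x + f x by ring.
  rewrite e1 natrD -[f y](subrK (f x)) e; ring.
(* The multipliers from 0 to 1 and from 1 to 0 are both 1. *)
have f1p : f (1 + p)%N = 1 + p%:R.
  have [k Kk e] := fP 0%N 1%N; move: (e); rewrite f0 f1 !subr0 mulr1 => k1.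
  by rewrite (shift _ _ _ Kk _ e) ?subr0 ?unitr1 // f1 -k1 mul1r.
have fp : f p = p%:R.
  have [k Kk e] := fP 1%N 0%N; move: (e); rewrite f0 f1 !sub0r mulrN1 => /oppr_inj k1.
  by rewrite -[p in LHS]add0n (shift _ _ _ Kk _ e) ?sub0r ?unitrN1 // f0 -k1 add0r mul1r.
move=> x; have [Ux|Ux] := U x.
  have [k Kk e] := fP x 0%N.
  have := shift _ _ _ Kk _ e; rewrite sub0r unitrN => /(_ Ux).
  rewrite add0n fp f0 add0r mulrC => /esym/(K1 _ Kk) k1; move: e.
  by rewrite f0 k1 mul1r !sub0r => /oppr_inj.
have [k Kk e] := fP x 1%N.
have := shift _ _ _ Kk _ e; rewrite -unitrN opprB => /(_ Ux).
rewrite f1p f1 mulrC => /addrI/esym/(K1 _ Kk) k1; move: e.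
by rewrite f1 k1 mul1r => /addrI/oppr_inj.
Qed.

Lemma coef_exp_XsubC (R : comNzRingType) (a : R) d j : (j <= d)%N ->
  (('X - a%:P) ^+ d)`_(d - j) = (- a) ^+ j *+ 'C(d, j).
Proof.
move=> jd; rewrite -polyCN exprDn coef_sum.
rewrite (bigD1 (Ordinal (jd : (j < d.+1)%N))) //= big1 ?addr0 => [|i ij].
  by rewrite -polyC_exp coefMn coefMC coefXn eqxx mul1r.
rewrite -polyC_exp coefMn coefMC coefXn; case: eqP => [e|_]; last first.
  by rewrite mul0r mul0rn.
by case/eqP: ij; apply: val_inj; have /= := ltn_ord i; lia.
Qed.

Lemma interpolation (F : finFieldType) (h : F -> F) :
  exists2 r : {poly F}, (size r <= #|F|)%N & forall a, r.[a] = h a.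
Proof.
pose L a := \prod_(b <- rem a (enum F)) ('X - b%:P).
exists (\sum_a (h a / (L a).[a]) *: L a) => [|z].
  apply: (leq_trans (size_sum _ _ _)); apply/bigmax_leqP=> a _.
  apply: (leq_trans (size_scale_leq _ _)).
  by rewrite size_prod_XsubC size_rem ?mem_enum // -cardE prednK // (cardD1 a).
have Lz a b : root (L a) b = (b != a).
  by rewrite root_prod_XsubC mem_rem_uniq ?enum_uniq // !inE mem_enum andbT.
rewrite horner_sum (bigD1 z) //= hornerZ mulfVK ?big1 ?addr0 // => [a za|].
  have /rootP La : root (L a) z by rewrite Lz eq_sym.
  by rewrite hornerZ La mulr0.
by have := Lz z z; rewrite rootE eqxx /= => ->.
Qed.

Lemma poly_ext (F : finFieldType) (r s : {poly F}) :
  (size r <= #|F|)%N -> (size s <= #|F|)%N -> (forall a, r.[a] = s.[a]) -> r = s.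
Proof.
move=> sr ss e; apply/eqP; rewrite -subr_eq0; apply/eqP.
apply: (@roots_geq_poly_eq0 _ _ (enum F)); rewrite ?enum_uniq //.
  by apply/allP=> a _; rewrite rootE hornerD hornerN e subrr.
by rewrite -cardE (leq_trans (size_polyD _ _)) // size_polyN geq_max sr.
Qed.

(** With g the inverse of f, the hypothesis reads (z - f y)^d = (g z - y)^d. Once the powers of g
    are interpolated, both sides have degree below p in z and agree as polynomials in z. Comparing
    coefficients makes each f^j with j <= d a polynomial of degree at most d; if f had degree m > 1,
    the first j with m j > d would contradict this. *)
Lemma rigid_prime (p d : nat) (f : 'F_p -> 'F_p) :
    prime p -> (0 < d)%N -> (d.*2 < p)%N -> f 0 = 0 -> f 1 = 1 ->
    (forall x y, (f y - f x) ^+ d = (y - x) ^+ d) ->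
  forall x, f x = x.
Proof.
move=> pp d0 dp f0 f1 fP.
have cF : #|'F_p| = p by exact: card_Fp.
have f_inj : injective f.
  move=> x y e; have := fP x y; rewrite e subrr expr0n gtn_eqF //= => /esym/eqP.
  by rewrite expf_eq0 d0 subr_eq0 => /eqP.
pose g := invF f_inj.
(* C(d, j) divides d!, which is prime to p since d < p. *)
have bin0 j : (j <= d)%N -> (-1) ^+ j *+ 'C(d, j) != 0 :> 'F_p.
  move=> jd; rewrite -mulr_natr mulf_neq0 ?signr_eq0 //.
  rewrite -(dvdn_pcharf (pchar_Fp pp)); apply: contra (prime_ndvd_fact pp (_ : d < p)%N).
    by rewrite -(bin_fact jd); exact: dvdn_mulr.
  by lia.
have powers j : (j <= d)%N -> exists2 T : {poly 'F_p}, (size T <= d.+1)%N &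
    forall y, T.[y] = f y ^+ j.
  move=> jd.
  have /fin_all_exists2[r r_size r_val] (i : 'I_d.+1) : exists2 r : {poly 'F_p},
      (size r <= p)%N & forall z, r.[z] = g z ^+ (d - i).
    by have := interpolation (fun z => g z ^+ (d - i)); rewrite cF.
  pose c i : 'F_p := (-1) ^+ i *+ 'C(d, i).
  have E y : ('X - (f y)%:P) ^+ d = \sum_(i < d.+1) (c i * y ^+ i) *: r i.
    apply: poly_ext; rewrite ?cF ?size_exp_XsubC; first by lia.
      apply: (leq_trans (size_sum _ _ _)); apply/bigmax_leqP=> i _.
      exact: leq_trans (size_scale_leq _ _) _.
    move=> z; rewrite horner_exp hornerXsubC horner_sum.
    have -> : (z - f y) ^+ d = (g z - y) ^+ d by rewrite -fP f_invF.
    rewrite exprBn; apply: eq_bigr => i _.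
    by rewrite hornerZ r_val /c !mulrnAl mulrAC.
  (* The coefficient of X^(d - j) is [c j] times f(y)^j on the left and the value of S at y on the
     right. *)
  pose S := \poly_(i < d.+1) (c i * (r (inord i))`_(d - j)).
  exists ((c j)^-1 *: S) => [|y].
    by apply: (leq_trans (size_scale_leq _ _)); exact: size_poly.
  have Ec : (('X - (f y)%:P) ^+ d)`_(d - j) = c j * f y ^+ j.
    by rewrite coef_exp_XsubC // exprNn mulrnAl.
  rewrite hornerZ; apply: (mulfI (bin0 j jd)); rewrite mulrA divff ?bin0 // mul1r.
  rewrite -[_ *+ _]/(c j) -Ec E coef_sum horner_poly; apply: eq_bigr => i _.
  by rewrite coefZ inord_val; ring.
have [P sP fE] := powers 1%N d0.
have {}fE y : P.[y] = f y by rewrite fE expr1.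
have sP2 : (size P <= 2)%N.
  rewrite leqNgt; apply/negP=> sP3; pose m := (size P).-1.
  have [m2 md] : (1 < m)%N /\ (m <= d)%N by rewrite /m; lia.
  (* The least j with d < m j. Since 2 <= m <= d, it is at most d, and m j <= m + d <= 2 d < p, so
     P^j is determined by its values. *)
  pose j := (d %/ m).+1.
  have jd : (j <= d)%N.
    have : (d %/ m <= d %/ 2)%N by apply: leq_div2l.
    by rewrite /j; lia.
  have jm1 : (d < m * j)%N by rewrite mulnC ltn_ceil // ltnW.
  have jm2 : (m * j <= m + d)%N by rewrite mulnS mulnC leq_add2l leq_trunc_div.
  have [T sT TE] := powers j jd.
  have P0 : P != 0 by rewrite -size_poly_eq0; lia.
  have sPj : size (P ^+ j) = (m * j).+1.
    by rewrite -(size_exp P j) prednK // size_poly_gt0 expf_neq0.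
  have eT : P ^+ j = T.
    apply: poly_ext => [||a]; last by rewrite horner_exp fE TE.
      by rewrite sPj cF (leq_ltn_trans jm2) // (leq_ltn_trans _ dp) // -addnn leq_add2r.
    by rewrite cF (leq_trans sT) // (leq_ltn_trans _ dp) // -addnn leq_addr.
  by move: sT; rewrite -eT sPj ltnS leqNgt jm1.
have fl y : f y = P`_0 + P`_1 * y.
  by rewrite -fE (horner_coef_wide _ sP2) !big_ord_recl big_ord0 /= expr0 mulr1 expr1 addr0.
have P0 : P`_0 = 0 by have := fl 0; rewrite f0 mulr0 addr0.
by move=> x; rewrite fl P0 add0r; have := fl 1; rewrite f1 P0 add0r mulr1 => <-; rewrite mul1r.
Qed.
End Rigidity.

(** * Rigidity modulo a prime power *)

Lemma expn_add1 a s : exists w, (1 + a) ^ s = 1 + s * a + a ^ 2 * w.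
Proof.
elim: s => [|s [w IH]]; first by exists 0; rewrite expn0 mul0n muln0.
by exists (s + w * (1 + a)); rewrite expnS IH; ring.
Qed.

(** Raising to the power p increases the valuation of k - 1 by exactly one: with a = p^j u, the
    terms C(p, i) a^i for i >= 2 are divisible by p^(j + 2). For i < p the binomial supplies a
    factor p; for i = p one needs j p >= j + 2, which fails only for p = 2 and j = 1. *)
Lemma expn_prime_step p j u : prime p -> 0 < j -> (p = 2 -> 1 < j) -> ~~ (p %| u) ->
  exists2 u', ~~ (p %| u') & (1 + p ^ j * u) ^ p = 1 + p ^ j.+1 * u'.
Proof.
move=> pp j0 j2 pu; have p1 := prime_gt1 pp.
pose a := p ^ j * u.
have /dvdnP[v vE] : p ^ j.+2 %| \sum_(i < p.-1) 'C(p, i.+2) * a ^ i.+2.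
  apply: dvdn_sum => i _; have [ip|ip] := ltnP i.+2 p.
    rewrite expnS dvdn_mul ?prime_dvd_bin // expnMn -expnM dvdn_mulr //.
    by rewrite dvdn_exp2l //; nia.
  rewrite dvdn_mull // expnMn -expnM dvdn_mulr // dvdn_exp2l //.
  by case: (p =P 2) => [/j2|]; nia.
exists (u + p * v); first by rewrite dvdn_addl ?dvdn_mulr.
rewrite expnDn -/a; case: p pp {j2 pu} p1 @a vE => [|[|p]] // _ _ a vE.
rewrite 2!big_ord_recl [\sum_(i < _) _](_ : _ = v * p.+2 ^ j.+2) => [|]; last first.
  by rewrite -vE; apply: eq_bigr => i _; rewrite exp1n mul1n.
rewrite (_ : nat_of_ord ord0 = 0) // (_ : nat_of_ord (lift ord0 ord0) = 1) //.
rewrite bin0 bin1 !exp1n !mul1n expn0 expn1 /a !expnS; ring.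
Qed.

Lemma expn_prime_lift p j l u : prime p -> 0 < j -> (p = 2 -> 1 < j) -> ~~ (p %| u) ->
  j <= l -> exists t, exists2 u', ~~ (p %| u') & (1 + p ^ j * u) ^ t = 1 + p ^ l * u'.
Proof.
move=> pp j0 j2 pu; elim: l => [|l IH] jl; first by move: j0; rewrite ltnNge jl.
have [e|ne] := eqVneq j l.+1; first by exists 1, u; rewrite ?expn1 ?e.
have jl' : j <= l by lia.
have [t [u' pu' e]] := IH jl'.
have [||u'' pu'' e'] := @expn_prime_step p l u' pp _ _ pu'; first by lia.
  by move/j2; lia.
by exists (t * p), u''; rewrite // expnM e.
Qed.

(** Some power of k is 1 + p^l u' with u' prime to p. As e <= 2 l, its s-th power is 1 + s p^l u'
    modulo p^e, so a suitable s reaches any z that is 1 modulo p^l. *)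
Lemma expn_cover p e l k z : prime p -> 0 < l -> l <= e -> e <= l.*2 ->
  k = 1 %[mod p] -> (p = 2 -> k = 1 %[mod 4]) -> k <> 1 %[mod p ^ l.+1] ->
  z = 1 %[mod p ^ l] -> exists t, z = k ^ t %[mod p ^ e].
Proof.
move=> pp l0 le el k1 k4 kn z1; have p1 := prime_gt1 pp; have p0 := prime_gt0 pp.
have pl1 : 1 < p ^ l by rewrite -(exp1n l) ltn_exp2r.
have pos d y : 1 < d -> y = 1 %[mod d] -> exists c, y = 1 + d * c.
  move=> d1 e1; exists (y %/ d); rewrite {1}(divn_eq y d) e1 modn_small //.
  by rewrite addnC mulnC.
have [a kE] := pos _ _ p1 k1; have [c zE] := pos _ _ pl1 z1.
have a0 : 0 < p * a by rewrite lt0n; apply/eqP=> a0; apply: kn; rewrite kE a0.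
pose j := logn p (p * a).
have [u cu uE] := pfactor_coprime pp a0.
have j0 : 0 < j by rewrite -(pfactor_dvdn 1 pp a0) expn1 dvdn_mulr.
have jl : j <= l.
  rewrite leqNgt -(pfactor_dvdn _ pp a0); apply/negP=> /dvdnP[x e1]; apply: kn.
  by rewrite kE e1 addnC modnMDl.
have j2 : p = 2 -> 1 < j.
  move=> p2; rewrite -(pfactor_dvdn 2 pp a0) p2.
  by move/eqP: (k4 p2); rewrite kE p2 (eqn_modDl 1 _ 0) mod0n.
have pu : ~~ (p %| u) by rewrite -prime_coprime.
have [t [u' pu' e']] := expn_prime_lift pp j0 j2 pu jl.
have ke : k ^ t = 1 + p ^ l * u' by rewrite -e' kE uE mulnC.
have cu' : coprime (p ^ e) u' by rewrite coprimeXl // prime_coprime.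
have pe0 : 0 < p ^ e by rewrite expn_gt0 p0.
have [i ei] := expn_inv 1 pe0 cu'.
(* Here s = c u'^i, with u'^i an inverse of u' modulo p^e. *)
exists (t * (c * u' ^ i)); rewrite expnM ke.
have [w ->] := expn_add1 (p ^ l * u') (c * u' ^ i).
have -> : 1 + c * u' ^ i * (p ^ l * u') + (p ^ l * u') ^ 2 * w =
   p ^ (l.*2 - e) * u' ^ 2 * w * p ^ e + (1 + (p ^ l * c) * (u' ^ i * u' ^ 1)).
  rewrite expnMn -expnM muln2 -[in p ^ l.*2](subnK el) expnD expn1; ring.
by rewrite modnMDl zE (modn_lin (erefl _) (erefl _) ei) muln1.
Qed.

(** * Normalised automorphisms at a single prime *)

Section LocalRigidity.
Variables (p e m q : nat) (g : nat -> nat).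
Hypotheses (pp : prime p) (e0 : 0 < e) (m0 : 0 < m) (cpm : coprime p m).
Hypothesis cq : coprime (p ^ e * m) q.
Hypothesis gP : color_preserving (p ^ e * m) q g.
Hypotheses (g0 : g 0 = 0 %[mod p ^ e * m]) (g1 : g 1 = 1 %[mod p ^ e * m]).

Let pe0 : 0 < p ^ e. Proof. by rewrite expn_gt0 prime_gt0. Qed.
Let n0 : 0 < p ^ e * m. Proof. by rewrite muln_gt0 pe0. Qed.
Let cpem : coprime (p ^ e) m. Proof. exact: coprimeXl. Qed.
Let dpe : p ^ e %| p ^ e * m. Proof. exact: dvdn_mulr. Qed.
Let dm : m %| p ^ e * m. Proof. exact: dvdn_mull. Qed.
Let p_pe : p %| p ^ e. Proof. by rewrite dvdn_exp. Qed.
Let cpq : coprime (p ^ e) q. Proof. exact: coprime_dvdl cq. Qed.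
Let cpq1 : coprime p q. Proof. exact: coprime_dvdl cpq. Qed.

(** The difference g y - g x is a multiple of y - x modulo n, hence modulo d. *)
Lemma local_congr d x y : d %| p ^ e * m -> x = y %[mod d] -> g x = g y %[mod d].
Proof.
move=> dn xy; have [i /(eq_modn_dvd dn) E] := gP x y.
apply/eqP; rewrite eq_sym -(eqn_modDr (q ^ i * x)) E; apply/eqP.
exact: modn_lin (erefl _) (erefl _) (esym xy).
Qed.

(** Replace x and y by points in the same classes modulo p^e that are 0 and 1 modulo m. There g
    takes the values 0 and 1 modulo m, so the multiplier is 1 modulo m. *)
Lemma local_diff x y : exists2 i, q ^ i = 1 %[mod m] &
  g y + q ^ i * x = g x + q ^ i * y %[mod p ^ e].
Proof.
pose x' := chinese (p ^ e) m x 0; pose y' := chinese (p ^ e) m y 1.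
have [i E] := gP x' y'; exists i.
  have := eq_modn_dvd dm E.
  have gx' : g x' = 0 %[mod m].
    by rewrite -(eq_modn_dvd dm g0); apply: local_congr; rewrite // chinese_modr.
  have gy' : g y' = 1 %[mod m].
    by rewrite -(eq_modn_dvd dm g1); apply: local_congr; rewrite // chinese_modr.
  rewrite (modn_lin gy' (erefl _) (chinese_modr cpem x 0)).
  rewrite (modn_lin gx' (erefl _) (chinese_modr cpem y 1)).
  by rewrite muln0 muln1 addn0 add0n.
have gx' : g x' = g x %[mod p ^ e] by apply: local_congr; rewrite // chinese_modl.
have gy' : g y' = g y %[mod p ^ e] by apply: local_congr; rewrite // chinese_modl.
have := eq_modn_dvd dpe E.
rewrite (modn_lin gy' (erefl _) (chinese_modl cpem x 0)).
by rewrite (modn_lin gx' (erefl _) (chinese_modl cpem y 1)).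
Qed.

(** Serves both for Z/p^e and for the field with p elements. *)
Lemma local_diff_ring (R : comNzRingType) :
    (forall a b, a = b %[mod p ^ e] -> a%:R = b%:R :> R)%R ->
  forall x y, exists2 k : R, (exists2 i, q ^ i = 1 %[mod m] & k = ((q ^ i)%:R)%R) &
    ((g y)%:R - (g x)%:R = k * (y%:R - x%:R))%R.
Proof.
move=> RP x y; have [i qi /RP E] := local_diff x y.
exists ((q ^ i)%:R)%R; first by exists i.
move: E; rewrite !natrD ![(_ * _)%:R%R]natrM => E.
have -> : ((g y)%:R = (g x)%:R + (q ^ i)%:R * y%:R - (q ^ i)%:R * x%:R :> R)%R.
  by rewrite -E addrK.
by ring.
Qed.

Lemma kernel_cover l :
    (forall z, coprime p z -> z = 1 %[mod p ^ l] ->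
       exists2 i, q ^ i = 1 %[mod m] & z = q ^ i %[mod p ^ e]) ->
  kernel_in_powers (p ^ l * m) (p ^ e * m) q.
Proof.
move=> H k ck k1; have [||i qi ki] := H k.
- exact: coprime_dvdl (dvdn_trans p_pe dpe) ck.
- exact: eq_modn_dvd (dvdn_mulr _ (dvdnn _)) k1.
exists i; apply/eqP; rewrite chinese_remainder // ki eqxx qi.
by rewrite (eq_modn_dvd (dvdn_mull _ (dvdnn m)) k1) eqxx.
Qed.

Lemma expn1_mod d i t : q ^ i = 1 %[mod d] -> q ^ (i * t) = 1 %[mod d].
Proof. by move=> qi; rewrite expnM -modnXm qi modnXm exp1n. Qed.

(** Used contrapositively: if K misses part of the kernel, a power of q that is 1 modulo m and
    modulo p (modulo 4 when p = 2) is 1 modulo p^(l + 1). *)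
Lemma cover_kernel i l : 0 < l -> l <= e -> e <= l.*2 -> q ^ i = 1 %[mod m] ->
    q ^ i = 1 %[mod p] -> (p = 2 -> q ^ i = 1 %[mod 4]) -> q ^ i <> 1 %[mod p ^ l.+1] ->
  kernel_in_powers (p ^ l * m) (p ^ e * m) q.
Proof.
move=> l0 le el qm qp q4 qn; apply: kernel_cover => z _ z1.
have [t zt] := expn_cover pp l0 le el qp q4 qn z1.
by exists (i * t); [exact: expn1_mod | rewrite expnM].
Qed.

Lemma local_rigid_odd : odd p -> 1 < e -> ~ kernel_in_powers (p ^ e.-1 * m) (p ^ e * m) q ->
  forall x, g x = x %[mod p ^ e].
Proof.
move=> op e1 nker x.
have pe1 : 1 < p ^ e by rewrite -(exp1n e) ltn_exp2r // prime_gt1.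
(* This is [cover_kernel] with l = e - 1; e <= 2 l because e > 1. *)
have inj i : q ^ i = 1 %[mod m] -> q ^ i = 1 %[mod p] -> q ^ i = 1 %[mod p ^ e].
  move=> qm qp; apply/eqP/negPn/negP=> /eqP ne; apply: nker.
  have e2 : e <= e.-1.*2 by clear -e1; lia.
  apply: (cover_kernel (i := i) _ _ e2 qm qp); rewrite ?prednK ?leq_pred //.
    by rewrite -ltnS prednK.
  by move=> p2; rewrite p2 in op.
apply/(eqr_modn _ _ pe1); move: x.
apply: (rigid_odd (p := p) _ _ (local_diff_ring _)).
- by have /(eqr_modn _ _ pe1) := eq_modn_dvd dpe g0.
- by have /(eqr_modn _ _ pe1) := eq_modn_dvd dpe g1.
- by move=> a b /(eqr_modn _ _ pe1).
- move=> _ _ c [i qi ->] [j qj ->] E.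
  have ij : q ^ i = q ^ j %[mod p].
    have : q ^ i = q ^ j + p * (c : nat) %[mod p ^ e].
      apply/(eqr_modn _ _ pe1); rewrite natrD natrM natr_Zp -E; ring.
    by move=> /(eq_modn_dvd p_pe) ->; rewrite addnC mulnC modnMDl.
  (* With q^r inverse to q^j, the power q^(r + i) is 1 modulo m and modulo p, hence modulo p^e. *)
  have [r qr] := expn_inv j n0 cq.
  have qrm : q ^ r = 1 %[mod m].
    by rewrite -(eq_modn_dvd dm qr) -modnMmr qj modnMmr muln1.
  have : q ^ (r + i) = 1 %[mod p ^ e].
    apply: inj.
      by rewrite expnD -modnMm qrm qi modnMm.
    by rewrite expnD -modnMmr ij modnMmr (eq_modn_dvd (dvdn_trans p_pe dpe) qr).
  rewrite -(eq_modn_dvd dpe qr) expnD => /(eqn_expMl pe0 cpq) E'.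
  exact/(eqr_modn _ _ pe1).
(* Cancelling p leaves a congruence modulo p^(e - 1), still a multiple of p, so [inj] applies. *)
- move=> _ [i qi ->]; rewrite -natrM => /(eqr_modn _ _ pe1) E.
  have pE : p ^ e = p * p ^ e.-1 by rewrite -expnS prednK.
  have E1 : p * q ^ i = p * 1 %[mod p * p ^ e.-1] by rewrite muln1 -pE.
  have E2 : q ^ i = 1 %[mod p ^ e.-1].
    by apply/eqP; move/eqP: E1; rewrite -!muln_modr eqn_pmul2l ?prime_gt0.
  apply/(eqr_modn _ 1 pe1); apply: inj => //.
  by apply: (eq_modn_dvd _ E2); rewrite dvdn_exp // -ltnS prednK.
move=> x; case: (boolP (p %| x)) => px; [right|left].
  case: x px => [|x] px; first by rewrite sub0r unitrN1.
  rewrite mulrS addrAC subrr add0r unitZpE // coprimeXl // prime_coprime //.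
  by apply: contraL px => px; rewrite -addn1 dvdn_addr // dvdn1 gtn_eqF // prime_gt1.
by rewrite unitZpE // coprimeXl // prime_coprime.
Qed.

(** Let k and 2 k - 1 lie in K_p and e > 2. If k is 1 modulo 4, it is 1 modulo 2^(e - 1), so 2 k =
    2. If k is 3 modulo 4, then 2 k - 1 is 5 modulo 8, and K_p is large enough to contain the
    excluded kernel. *)
Lemma local_rigid_two : p = 2 -> (2 < e -> ~ kernel_in_powers (p ^ e.-2 * m) (p ^ e * m) q) ->
  forall x, g x = x %[mod p ^ e].
Proof.
move=> p2 nker x.
have pe1 : 1 < p ^ e by rewrite -(exp1n e) ltn_exp2r // prime_gt1.
apply/(eqr_modn _ _ pe1); move: x.
apply: (rigid_two _ _ (local_diff_ring _)).
- by have /(eqr_modn _ _ pe1) := eq_modn_dvd dpe g0.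
- by have /(eqr_modn _ _ pe1) := eq_modn_dvd dpe g1.
- by move=> a b /(eqr_modn _ _ pe1).
move=> _ [i qi ->] [j qj E].
suff : 2 * q ^ i = 2 %[mod p ^ e] by move/(eqr_modn _ _ pe1); rewrite natrM.
have {}E : 2 * q ^ i = q ^ j + 1 %[mod p ^ e].
  by apply/(eqr_modn _ _ pe1); rewrite natrM natrD -E subrK.
have oq : odd q by move: cpq1; rewrite p2 coprime2n.
have oqX k : odd (q ^ k) by rewrite oddX oq orbT.
have := oqX i; have := oqX j => oj oi.
(* For e <= 2 the oddness of k suffices. *)
have [e3|e3] := ltnP 2 e; last first.
  have : e = 1 \/ e = 2 by clear - e0 e3; lia.
  have [ok2 ok4] : 2 * q ^ i = 2 %[mod 2] /\ 2 * q ^ i = 2 %[mod 4] by clear - oi; lia.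
  by case=> eE; rewrite eE p2; [exact: ok2 | exact: ok4].
have {}nker := nker e3.
(* For e > 3, [cover_kernel] applies with l = e - 2, as e <= 2 l; for e = 3 the modulus 2^(e - 1) is
   4. *)
have A k : q ^ k = 1 %[mod m] -> q ^ k = 1 %[mod 4] -> q ^ k = 1 %[mod 2 ^ e.-1].
  move=> km k4; have [e4|e4] := ltnP 3 e; last first.
    by have -> : e = 3 by clear - e3 e4; lia.
  apply/eqP/negPn/negP=> /eqP ne; apply: nker.
  have l1 : 0 < e.-2 by clear - e3; lia.
  have l2 : e.-2 <= e by clear - e3; lia.
  have l3 : e <= e.-2.*2 by clear - e4; lia.
  have l4 : e.-2.+1 = e.-1 by clear - e3; lia.
  apply: (cover_kernel (i := k) l1 l2 l3 km); rewrite ?p2 ?l4 //.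
  by rewrite !modn2 oqX.
have pE : p ^ e = 2 * 2 ^ e.-1 by rewrite p2 -expnS prednK.
have [i4|i4] := eqVneq (q ^ i %% 4) 1.
  have : 2 * q ^ i = 2 * 1 %[mod 2 * 2 ^ e.-1] by rewrite -!muln_modr (A i).
  by rewrite muln1 -pE.
have d8 : 8 %| p ^ e by rewrite p2 (dvdn_exp2l 2 e3).
have E8 := eq_modn_dvd d8 E.
have j8 : q ^ j %% 8 = 5 by clear - oi i4 E8 oj; lia.
case: nker.
have [e4|e4] := ltnP 3 e.
  have j1 : q ^ j = 1 %[mod 2 ^ e.-1] by apply: A => //; clear - j8; lia.
  have e4' : 3 <= e.-1 by clear - e4; lia.
  by have := eq_modn_dvd (dvdn_exp2l 2 e4') j1; rewrite j8.
have eE : e = 3 by clear - e3 e4; lia.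
(* An element that is 3 modulo 4 and one that is 5 modulo 8 generate all units modulo 8. *)
apply: kernel_cover => z cz _; rewrite p2 eE.
have oz : odd z by move: cz; rewrite p2 coprime2n.
have : [\/ z = 1 %[mod 8], z = q ^ i %[mod 8], z = q ^ j %[mod 8] | z = q ^ i * q ^ j %[mod 8]].
  rewrite -[q ^ i * _ %% 8]modnMmr j8.
  have : z %% 8 = 1 \/ z %% 8 = q ^ i %% 8 \/ z %% 8 = 5 \/ z %% 8 = (q ^ i * 5) %% 8.
    by clear - oz oi i4 j8; lia.
  by case=> [|[|[|]]] ->; [constructor 1 | constructor 2 | constructor 3 | constructor 4].
case=> ze; [exists 0 | exists i | exists j | exists (i + j)] => //.
  by rewrite expnD -modnMm qi qj modnMm.
by rewrite expnD.
Qed.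

(** K_p is generated by Q, of order d modulo p. All multipliers are powers of Q, so their d-th
    powers are 1 modulo p and [rigid_prime] applies once 2 d < p. *)
Lemma local_rigid_prime : e = 1 -> ~ kernel_in_powers m (p ^ e * m) q -> 3 < p ->
  forall x, g x = x %[mod p ^ e].
Proof.
move=> e1 nker p3 x; have p0 := prime_gt0 pp.
have peE : p ^ e = p by rewrite e1.
have dp : p %| p ^ e * m by apply: dvdn_trans dpe.
have cmq : coprime m q := coprime_dvdl dm cq.
pose Q := q ^ ordmod m q; have cQ : coprime p Q by rewrite coprimeXr.
pose d := ordmod p Q.
have d0 : 0 < d by exact: order_gt0.
have dd : d %| p.-1.
  by rewrite -totient_prime // -card_units_Zp //; apply: order_dvdG; rewrite inE.
have d2 : d.*2 < p.
  (* The quotient (p - 1) / d is not 0; if it is 1, then Q generates all units modulo p and K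
     contains the kernel; if it is at least 2, the bound follows. *)
  case/dvdnP: dd => -[|[|c]] pE.
  - by move: (prime_gt1 pp) pE; clear; lia.
  - case: nker; rewrite -[m in kernel_in_powers m]mul1n -(expn0 p).
    apply: kernel_cover => z cz _.
    have : zunit p z \in <[zunit p Q]>%g.
      suff -> : <[zunit p Q]>%g = units_Zp p by rewrite inE.
      apply/eqP; rewrite eqEcard subsetT card_units_Zp // totient_prime // pE mul1n.
      exact: leqnn.
    case/zunit_cycle => // t zt; exists (ordmod m q * t).
      by apply/expn_ordmod => //; exact: dvdn_mulr.
    by rewrite peE zt expnM.
  - by move: p0 pE; clear; nia.
pose f (a : 'F_p) : 'F_p := ((g a)%:R)%R.
have fR a : f (a%:R)%R = ((g a)%:R)%R.
  by apply/(eqr_Fp _ _ pp)/local_congr => //; rewrite val_Fp_nat // modn_mod.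
suff fid a : f a = a.
  by rewrite peE; apply/(eqr_Fp _ _ pp); rewrite -fR fid.
apply: (rigid_prime pp d0 d2) => [||{}x y].
- by rewrite /f; apply/(eqr_Fp _ 0 pp); exact: eq_modn_dvd g0.
- have -> : (1 = 1%:R :> 'F_p)%R by [].
  by rewrite fR; apply/(eqr_Fp _ _ pp); exact: eq_modn_dvd g1.
have [k [i /(expn_ordmod _ m0 cmq)/dvdnP[t iE] kE] E] := local_diff_ring (R := 'F_p)
  (fun a b => (fun h : a = b %[mod p ^ e] =>
     proj2 (eqr_Fp a b pp) (eq_modn_dvd p_pe h))) x y.
rewrite /f E !natr_Zp exprMn.
suff -> : (k ^+ d = 1)%R by rewrite mul1r.
rewrite kE -natrX; apply/(eqr_Fp _ 1 pp).
have Qd : Q ^ d = 1 %[mod p] by apply/expn_ordmod.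
have -> : (q ^ i) ^ d = (Q ^ d) ^ t by rewrite -!expnM iE; congr (_ ^ _); ring.
by rewrite -modnXm Qd modnXm exp1n.
Qed.

(** Multipliers are nonzero modulo 3, so g is injective modulo 3; fixing 0 and 1, it also fixes
    2. *)
Lemma local_rigid_three : p = 3 -> e = 1 -> forall x, g x = x %[mod p ^ e].
Proof.
move=> p3 e1 x.
have peE : p ^ e = 3 by rewrite e1 p3.
have d3 : 3 %| p ^ e * m by rewrite -peE.
have h0 := eq_modn_dvd d3 g0; have h1 := eq_modn_dvd d3 g1.
have q3 i : q ^ i %% 3 = 1 \/ q ^ i %% 3 = 2.
  have : coprime 3 (q ^ i) by rewrite coprimeXr // -p3.
  by rewrite prime_coprime //; clear; lia.
have h2 : g 2 = 2 %[mod 3].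
  have [i _] := local_diff 0 2; have [j _] := local_diff 1 2.
  rewrite peE; have := q3 i; have := q3 j.
  clear - h0 h1; move: (q ^ i) (q ^ j) => a b; lia.
have xr := local_congr (y := x %% 3) d3 (esym (modn_mod _ _)).
rewrite peE xr -[RHS](modn_mod x 3).
have := ltn_pmod x (isT : 0 < 3); case: (x %% 3) => [|[|[|]]] //.
Qed.

(** The hypotheses are the failures of (E1), (E2) and (E3) at p; the values of p^e to which none of
    them applies are 2, 3 and 4. *)
Lemma local_rigid :
    (3 < p -> e = 1 -> ~ kernel_in_powers m (p ^ e * m) q) ->
    (odd p -> 1 < e -> ~ kernel_in_powers (p ^ e.-1 * m) (p ^ e * m) q) ->
    (p = 2 -> 2 < e -> ~ kernel_in_powers (p ^ e.-2 * m) (p ^ e * m) q) ->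
  forall x, g x = x %[mod p ^ e].
Proof.
move=> H1 H2 H3.
have [p2|op] := even_prime pp; first by apply: local_rigid_two => //; exact: H3.
have [e1|e1] := ltnP 1 e; first exact: local_rigid_odd (H2 op e1).
have {}e1 : e = 1 by clear - e0 e1; lia.
have [p3|p3] := ltnP 3 p; first exact: local_rigid_prime (H1 p3 e1) p3.
apply: local_rigid_three => //; move: (odd_prime_gt2 op pp); clear - p3; lia.
Qed.

End LocalRigidity.

(** * Assembling the prime components *)

Lemma eq_modn_parts n a b : 0 < n ->
  (forall p, p \in primes n -> a = b %[mod n`_p]) -> a = b %[mod n].
Proof.
move=> n0; wlog ba : a b / b <= a => [W|] H.
  have [|/ltnW] := leqP b a => ab; first exact: W.
  by apply/esym/W => // p /H.
apply/eqP; rewrite eqn_mod_dvd //; apply/dvdn_partP => // p pn.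
by rewrite -eqn_mod_dvd //; apply/eqP/H.
Qed.

(** Composing s with an affine map gives g fixing 0 and 1. If g were the identity modulo every
    prime-power part of n, then s would be affine. *)
Lemma nonaffine_normalized n q s : 0 < n -> coprime n q ->
  s \in cyc_aut n q -> s \notin cyc_aff n q ->
  exists2 g, [/\ color_preserving n q g, g 0 = 0 %[mod n] & g 1 = 1 %[mod n]] &
  exists2 p, p \in primes n & exists x, g x <> x %[mod n`_p].
Proof.
move=> n0 cq sA sF; have fP := cyc_aut_preserving n0 cq sA.
set f := fun x => _ in fP.
have [i e01] := fP 0 1; have [j ji] := expn_inv i n0 cq.
(* Modulo n this is (f x - f 0) / (f 1 - f 0), since f 1 - f 0 = q^i. *)
pose g x := q ^ j * (f x + n.-1 * f 0).
have f00 x : x + f 0 + n.-1 * f 0 = x %[mod n].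
  by rewrite -addnA -mulSn prednK // addnC mulnC modnMDl.
have gE x : g x = x %[mod n] -> f x = q ^ i * x + f 0 %[mod n].
  move=> gx; apply/eqP; rewrite -(eqn_modDr (n.-1 * f 0)) f00; apply/eqP.
  apply: (eqn_expMl (i := j) n0 cq); rewrite -/(g x) gx.
  by rewrite mulnA -modnMml ji modnMml mul1n.
exists g.
  split=> [x y||].
  - have [k E] := fP x y; exists (j + k).
    rewrite /g expnD -!mulnA -!mulnDr -modnMmr addnAC -modnDml E modnDml modnMmr.
    by congr (_ %% _); ring.
  - by rewrite /g -modnMmr (f00 0) mod0n muln0 mod0n.
  have f1 : f 1 = q ^ i + f 0 %[mod n] by move: e01; rewrite muln0 muln1 addn0 addnC.
  by rewrite /g -modnMmr -modnDml f1 modnDml f00 modnMmr.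
(* Letting x range over ['I_n] keeps the claim boolean, so a failing prime and point can be
   extracted. *)
have : ~~ all (fun p : nat => [forall x : 'I_n, g x == x %[mod n`_p]]) (primes n).
  apply: contra sF => /allP H; apply/(cyc_affP _ n0 cq); exists i, (f 0) => x.
  have xn : x %% n < n by rewrite ltn_mod.
  have fE : f x = f (x %% n).
    by rewrite /f; congr (nat_of_ord (s _)); apply/Zmod_of_eq => //; rewrite modn_mod.
  rewrite -[LHS]Zmod_ofK -/(f x) fE; apply/Zmod_of_eq => //.
  rewrite gE; first by rewrite -modnDml modnMmr modnDml.
  by apply: eq_modn_parts => // p /H/forallP/(_ (Ordinal xn))/eqP.
by case/allPn=> p pn /forallPn[x /eqP gx]; exists p => //; exists x.
Qed.

Theorem theorem2 (q n : nat) (hq : prime_power q) (hn : 0 < n)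
    (hnq : coprime n q) :
  cyc_aut n q <> cyc_aff n q <->
  [\/ exists p : nat,
        [/\ prime p, 5 <= p, exactly_divides p n
          & idxmod (n %/ p) q = idxmod n q],
      exists p : nat,
        [/\ prime p, odd p, p ^ 2 %| n
          & idxmod (n %/ p) q = idxmod n q]
    | 8 %| n /\ idxmod (n %/ 4) q = idxmod n q].
Proof.
split=> [neq|]; last first.
  case=> [[p [pp p5 /andP[/dvdnP[m nE] p2]]]|[p [pp op /dvdnP[c nE]]]|[/dvdnP[w nE]]].
  - subst n; move: (hn); rewrite muln_gt0 => /andP[m0 p0]; rewrite mulnK // => E.
    apply: cyc_aut_neq_transposition => //; last first.
      exact: (proj1 (idxmod_eqP hn (dvdn_mulr _ (dvdnn _)) hnq) E).
    rewrite coprime_sym prime_coprime //; apply: contra p2 => pm.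
    exact: dvdn_mul.
  - move: nE; rewrite expnS expn1 mulnA => nE; subst n.
    move: (hn); rewrite muln_gt0 => /andP[c0 p0]; rewrite mulnK // => E.
    apply: cyc_aut_neq_odd => //; first exact: dvdn_mull.
    exact: (proj1 (idxmod_eqP hn (dvdn_mulr _ (dvdnn _)) hnq) E).
  - move: nE; rewrite -[8]/(2 * 4) mulnA => nE; subst n.
    move: (hn); rewrite muln_gt0 => /andP[w0 _]; rewrite mulnK // => E.
    apply: cyc_aut_neq_two => //; first exact: dvdn_mull.
    exact: (proj1 (idxmod_eqP hn (dvdn_mulr _ (dvdnn _)) hnq) E).
have [s sA sF] : exists2 s, s \in cyc_aut n q & s \notin cyc_aff n q.
  by apply/subsetPn; apply: contra_notN neq => sub; apply/eqP; rewrite eqEsubset sub cyc_aff_sub.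
(* The exception is found at a prime p where g is not the identity. *)
have [g [gP g0 g1] [p pn [x gx]]] := nonaffine_normalized hn hnq sA sF.
move: pn; rewrite mem_primes => /and3P[pp _ pn]; have p0 := prime_gt0 pp.
move: gx; rewrite p_part; set e := logn p n => gx.
have e0 : 0 < e by rewrite /e -pfactor_dvdn.
have [m cpm] := pfactor_coprime pp hn; rewrite -/e mulnC => nE.
clearbody e; subst n.
have m0 : 0 < m by move: hn; rewrite muln_gt0 => /andP[].
have divE k : k <= e -> (p ^ e * m) %/ p ^ k = p ^ (e - k) * m.
  by move=> ke; rewrite -{1}(subnK ke) expnD mulnAC mulnK // expn_gt0 p0.
have ker k : k <= e -> kernel_in_powers (p ^ (e - k) * m) (p ^ e * m) q ->
    idxmod ((p ^ e * m) %/ p ^ k) q = idxmod (p ^ e * m) q.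
  move=> ke H; rewrite divE //; apply/idxmod_eqP => //.
  by rewrite dvdn_mul // dvdn_exp2l // leq_subr.
have [/and3P[p5 /eqP e1 /eqP E]|N1] := boolP [&& 4 < p, e == 1 &
    idxmod ((p ^ e * m) %/ p) q == idxmod (p ^ e * m) q].
  constructor 1; exists p; split=> //; rewrite /exactly_divides pn e1 expn1 expnS expn1.
  by rewrite dvdn_pmul2l // -prime_coprime.
have [/and3P[op e1 /eqP E]|N2] := boolP [&& odd p, 1 < e &
    idxmod ((p ^ e * m) %/ p) q == idxmod (p ^ e * m) q].
  by constructor 2; exists p; split=> //; rewrite dvdn_mulr // dvdn_exp2l.
have [/and3P[/eqP p2 e2 /eqP E]|N3] := boolP [&& p == 2, 2 < e &
    idxmod ((p ^ e * m) %/ 4) q == idxmod (p ^ e * m) q].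
  by constructor 3; split=> //; rewrite p2; exact: dvdn_mulr (dvdn_exp2l 2 e2).
(* With all three conditions failing at p, [local_rigid] makes g the identity modulo p^e, against
   the choice of x. *)
case: gx; apply: local_rigid hnq gP g0 g1 _ _ _ x => //.
- move=> p3 e1 H; case/negP: N1; apply/and3P; split; last 1 first.
  + apply/eqP; rewrite -[X in _ %/ X]expn1; apply: ker => //.
    by move: H; rewrite e1 subnn mul1n.
  + rewrite ltn_neqAle p3 andbT; apply/eqP=> p4.
    by move: pp; rewrite -p4.
  + exact/eqP.
- move=> op e1 H; case/negP: N2; rewrite op e1 /=.
  by apply/eqP; rewrite -[X in _ %/ X]expn1; apply: ker; rewrite // subn1.
move=> p2 e2 H; case/negP: N3; apply/and3P; split=> //; first exact/eqP.
have p4 : p ^ 2 = 4 by rewrite p2.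
by apply/eqP; rewrite -p4; apply: ker; rewrite ?subn2 // ltnW.
Qed.
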